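(* The energy of a vertex, regarded as a payoff for the energy game on graphs, satisfies the axioms of symmetry, efficiency and null player. That is, for every graph $G=(V,E)$ with $V=\{v_1,\dots,v_n\}$ and energy game $(V,w)$, $w(S)=\mathcal{E}(I(S))$ for $S\subset V$: (Efficiency) $\sum_{i=1}^n\mathcal{E}_G(v_i)=w(V)$; (Symmetry) if $v_i$ and $v_j$ are symmetric players in $(V,w)$, then $\mathcal{E}_G(v_i)=\mathcal{E}_G(v_j)$; (Null player) if $v_i$ is a null player in $(V,w)$, then $\mathcal{E}_G(v_i)=0$.
   Context: Graphs are finite, simple and undirected. For a graph $G$ with vertices $v_1,\dots,v_n$, the adjacency matrix $A(G)$ is the $n\times n$ matrix with $A_{ij}=1$ if $v_i$ and $v_j$ are adjacent and $A_{ij}=0$ otherwise. For a matrix $M$, $|M|=(MM^* )^{1/2}$. The energy of $G$ is $\mathcal{E}(G)=\operatorname{Tr}(|A(G)|)$, i.e. the sum of the absolute values of the eigenvalues of $A(G)$ counted with multiplicity (the empty graph has energy $0$). The energy of the vertex $v_i$ in $G$ is $\mathcal{E}_G(v_i)=|A(G)|_{ii}$. For $S\subset V$, $I(S)$ denotes the subgraph of $G$ induced by $S$. Players $v_i,v_j$ are symmetric in $(V,w)$ if $w(S\cup\{v_i\})=w(S\cup\{v_j\})$ for every $S\subset V\setminus\{v_i,v_j\}$. A player $v_i$ is null in $(V,w)$ if $w(S\cup\{v_i\})-w(S)=0$ for every $S\subset V$. *)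

(* Defs.v *)
From mathcomp Require Import all_boot all_order all_algebra.

Set Implicit Arguments.
Unset Strict Implicit.
Unset Printing Implicit Defensive.

Import Order.TTheory GRing.Theory Num.Theory.
Local Open Scope ring_scope.
Local Open Scope sesquilinear_scope.

(* Throughout, C : numClosedFieldType plays the role of the complex numbers. *)

Record sgraph (n : nat) := SGraph {
  adj : rel 'I_n;
  adj_sym : symmetric adj;
  adj_irrefl : irreflexive adj }.

Lemma induced_sym n (G : sgraph n) (S : {set 'I_n}) :
  symmetric (fun i j : 'I_#|S| => adj G (enum_val i) (enum_val j)).
Proof. by move=> i j; rewrite adj_sym. Qed.

Lemma induced_irrefl n (G : sgraph n) (S : {set 'I_n}) :
  irreflexive (fun i j : 'I_#|S| => adj G (enum_val i) (enum_val j)).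
Proof. by move=> i; rewrite adj_irrefl. Qed.

(* The vertices of S are renumbered increasingly, by enum_val : 'I_#|S| -> 'I_n. *)
Definition induced n (G : sgraph n) (S : {set 'I_n}) : sgraph #|S| :=
  SGraph (@induced_sym n G S) (@induced_irrefl n G S).

Definition adjmx (C : numClosedFieldType) n (G : sgraph n) : 'M[C]_n :=
  \matrix_(i, j) (adj G i j)%:R.

Definition psdmx (C : numClosedFieldType) n (B : 'M[C]_n) : Prop :=
  B ^t* = B /\ forall u : 'rV[C]_n, 0 <= (u *m B *m u ^t*) 0 0.

(* H^(1/2) by spectral calculus: H = P^-1 *m diag_mx X *m P with P unitary.
   Meaningful for positive semidefinite H only; see psd_sqrtmx, sqr_sqrtmx and
   sqrtmx_unique. *)
Definition sqrtmx (C : numClosedFieldType) n (H : 'M[C]_n) : 'M[C]_n :=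
  invmx (spectralmx H) *m diag_mx (map_mx sqrtC (spectral_diag H))
    *m spectralmx H.

Definition absmx (C : numClosedFieldType) n (M : 'M[C]_n) : 'M[C]_n :=
  sqrtmx (M *m M ^t*).

Definition energy (C : numClosedFieldType) n (G : sgraph n) : C :=
  \tr (absmx (adjmx C G)).

Definition vertex_energy (C : numClosedFieldType) n (G : sgraph n) (i : 'I_n) :
  C := absmx (adjmx C G) i i.

Definition energy_game (C : numClosedFieldType) n (G : sgraph n)
  (S : {set 'I_n}) : C := energy C (induced G S).

Definition symmetric_players (R : zmodType) n (w : {set 'I_n} -> R)
    (i j : 'I_n) : Prop :=
  forall S : {set 'I_n}, S \subset [set: 'I_n] :\: [set i; j] ->
    w (S :|: [set i]) = w (S :|: [set j]).

Definition null_player (R : zmodType) n (w : {set 'I_n} -> R) (i : 'I_n) :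
  Prop := forall S : {set 'I_n}, w (S :|: [set i]) - w S = 0.

Section SqrtmxTheory.
Variable C : numClosedFieldType.

Lemma trCmx_mul m n p (A : 'M[C]_(m, n)) (B : 'M[C]_(n, p)) :
  (A *m B) ^t* = B ^t* *m A ^t*.
Proof. by rewrite trmx_mul map_mxM. Qed.

Lemma psd_mulmx_trC n (M : 'M[C]_n) : psdmx (M *m M ^t*).
Proof.
split=> [|u]; first by rewrite trCmx_mul trmxCK.
have -> : u *m (M *m M ^t*) *m u ^t* = (u *m M) *m (u *m M) ^t*.
  by rewrite trCmx_mul !mulmxA.
by rewrite mxE sumr_ge0 // => k _; rewrite !mxE mul_conjC_ge0.
Qed.

Lemma psd_spectral n (H : 'M[C]_n) : psdmx H ->
  H = (spectralmx H) ^t* *m diag_mx (spectral_diag H) *m spectralmx H /\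
  forall i, 0 <= spectral_diag H 0 i.
Proof.
move=> [Hh Hp].
have Pu := spectral_unitarymx H.
have HE : H = (spectralmx H) ^t* *m diag_mx (spectral_diag H) *m spectralmx H.
  rewrite -invmx_unitary //; apply/orthomx_spectralP.
  by apply/normalmxP; rewrite Hh.
split=> // i; have := Hp (row i (spectralmx H)).
have Pi : row i (spectralmx H) *m (spectralmx H) ^t* = delta_mx 0 i.
  by rewrite -row_mul (unitarymxP Pu) row1.
have Pi' : spectralmx H *m (row i (spectralmx H)) ^t* = delta_mx i 0.
  rewrite -[LHS]trmxCK trCmx_mul trmxCK Pi; apply/matrixP=> a b.
  by rewrite !mxE andbC conjC_nat.
rewrite {2}HE !mulmxA Pi -mulmxA Pi' -rowE.
rewrite mxE (bigD1 i) //= big1 ?addr0; last first.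
  by move=> k ki; rewrite !mxE (negPf ki) mulr0.
by rewrite !mxE !eqxx mulr1 mulr1n.
Qed.

Lemma psd_conj_diag n (P : 'M[C]_n) (d : 'rV[C]_n) :
  (forall i, 0 <= d 0 i) -> psdmx (P ^t* *m diag_mx d *m P).
Proof.
move=> d0; split=> [|u].
  rewrite !trCmx_mul trmxCK mulmxA; congr (_ *m _ *m _).
  apply/matrixP=> i j; rewrite !mxE eq_sym.
  by case: eqP => [->|_]; rewrite ?mulr0n ?conjC0 // mulr1n geC0_conj.
have -> : u *m (P ^t* *m diag_mx d *m P) *m u ^t* =
    (u *m P ^t*) *m diag_mx d *m (u *m P ^t*) ^t*.
  by rewrite trCmx_mul trmxCK !mulmxA.
rewrite mxE sumr_ge0 // => k _; rewrite mul_mx_diag !mxE.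
by rewrite mulrAC mulr_ge0 // mul_conjC_ge0.
Qed.

Lemma psd_sqrtmx n (H : 'M[C]_n) : psdmx H -> psdmx (sqrtmx H).
Proof.
move=> /psd_spectral[_ d0]; rewrite /sqrtmx invmx_unitary ?spectral_unitarymx //.
by apply: psd_conj_diag => i; rewrite mxE sqrtC_ge0.
Qed.

Lemma sqr_sqrtmx n (H : 'M[C]_n) : psdmx H -> sqrtmx H *m sqrtmx H = H.
Proof.
move=> /psd_spectral[HE d0]; rewrite {3}HE -invmx_unitary ?spectral_unitarymx //.
rewrite /sqrtmx !mulmxA mulmxK ?spectral_unit //; congr (_ *m _).
rewrite -mulmxA mulmx_diag; congr (_ *m diag_mx _); apply/rowP=> i.
by rewrite !mxE -expr2 sqrtCK.
Qed.

Lemma sqrtmx_unique n (H B : 'M[C]_n) :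
  psdmx B -> B *m B = H -> sqrtmx H = B.
Proof.
move=> psdB BB.
have psdH : psdmx H by rewrite -BB -{2}psdB.1; apply: psd_mulmx_trC.
have [BE d0] := psd_spectral psdB.
have [SE e0] := psd_spectral (psd_sqrtmx psdH).
have := sqr_sqrtmx psdH; rewrite -[RHS]BB.
move: (spectral_unitarymx B) (spectral_unitarymx (sqrtmx H)).
move: (sqrtmx H) SE e0 => S.
move: (spectralmx S) (spectral_diag S) => V e SE e0.
move: (spectralmx B) (spectral_diag B) BE d0 => U d BE d0 Uu Vu SSBB.
pose W := V *m U ^t*.
have VV : V *m V ^t* = 1%:M by apply/unitarymxP.
have UU : U *m U ^t* = 1%:M by apply/unitarymxP.
have VV' : V ^t* *m V = 1%:M by apply: mulmx1C.
have UU' : U ^t* *m U = 1%:M by apply: mulmx1C.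
have VS : V *m S = diag_mx e *m V by rewrite SE !mulmxA VV mul1mx.
have BU : B *m U ^t* = U ^t* *m diag_mx d by rewrite {1}BE -mulmxA UU mulmx1.
have WW : diag_mx e *m W = W *m diag_mx d.
  have : diag_mx e *m (diag_mx e *m W) = W *m diag_mx d *m diag_mx d.
    have <- : V *m (S *m S) *m U ^t* = diag_mx e *m (diag_mx e *m W).
      by rewrite !mulmxA VS -(mulmxA _ V) VS !mulmxA.
    have <- : V *m (B *m B) *m U ^t* = W *m diag_mx d *m diag_mx d.
      by rewrite -!mulmxA BU (mulmxA B) BU !mulmxA.
    by rewrite SSBB.
  move=> /matrixP EW; apply/matrixP=> i j; have := EW i j.
  rewrite !mul_diag_mx !mul_mx_diag !mxE; move: (\sum_k _) => x /eqP.
  rewrite mulrA -expr2 -mulrA -expr2 [x * _ ^+ 2]mulrC -subr_eq0 -mulrBl.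
  rewrite mulf_eq0 => /orP[|/eqP->]; last by rewrite mulr0 mul0r.
  by rewrite subr_eq0 eqrXn2 // => /eqP->; rewrite mulrC.
have -> : S = V ^t* *m (diag_mx e *m W) *m U.
  by rewrite {1}SE /W -!mulmxA UU' mulmx1.
by rewrite WW {1}BE /W !mulmxA VV' mul1mx.
Qed.

End SqrtmxTheory.

(* Main.v *)
Require Import Defs.
From mathcomp Require Import all_boot all_order all_algebra perm.

(** The vertex energy is invariant under graph isomorphism, and the energy of a
    graph vanishes exactly when the graph has no edges; so the energy game on
    sets of at most two vertices already determines adjacency. Hence symmetric
    players [i], [j] have the same neighbours outside [{i, j}] (take [S = {k}]),
    the transposition [(i j)] is an automorphism of [G], and the energies of [i]
    and [j] agree. A null player is an isolated vertex, so its row in [A], hence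
    in [|A|], is zero. *)

Set Implicit Arguments.
Unset Strict Implicit.
Unset Printing Implicit Defensive.

Import Order.TTheory GRing.Theory Num.Theory.
Local Open Scope ring_scope.
Local Open Scope sesquilinear_scope.

Section AbsoluteValue.
Variable C : numClosedFieldType.

Lemma psd_absmx n (M : 'M[C]_n) : psdmx (absmx M).
Proof. exact/psd_sqrtmx/psd_mulmx_trC. Qed.

Lemma sqr_absmx n (M : 'M[C]_n) : absmx M *m absmx M = M *m M ^t*.
Proof. exact/sqr_sqrtmx/psd_mulmx_trC. Qed.

(** Positive semidefinite square roots are unique, so it suffices that the right-hand side is
    positive semidefinite and has the correct square; there the inner [P ^t* *m P] cancels. *)
Lemma absmx_conj_isometry m n (P : 'M[C]_(m, n)) (M : 'M[C]_n) :
  P ^t* *m P = 1%:M -> absmx (P *m M *m P ^t*) = P *m absmx M *m P ^t*.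
Proof.
move=> PP; have [herm pos] := psd_absmx M.
have mulP (X Y : 'M[C]_n) :
    (P *m X *m P ^t*) *m (P *m Y *m P ^t*) = P *m (X *m Y) *m P ^t*.
  by rewrite !mulmxA -(mulmxA _ (P ^t*) P) PP mulmx1.
apply: sqrtmx_unique; last by rewrite mulP sqr_absmx !trCmx_mul trmxCK -mulP !mulmxA.
split=> [|u]; first by rewrite (trCmx_mul _ (P ^t*)) trCmx_mul trmxCK herm mulmxA.
by have := pos (u *m P); rewrite trCmx_mul !mulmxA.
Qed.

(** Reindexing is conjugation by the permutation matrix [P] of [f]. The sizes [m] and [n] stay
    distinct because [#|[set: 'I_n]|] and [n] are equal but not convertible. *)
Lemma absmx_reindex m n (f : 'I_m -> 'I_n) (M : 'M[C]_n) :
  bijective f -> absmx (mxsub f f M) = mxsub f f (absmx M).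
Proof.
move=> bijf; pose P : 'M[C]_(m, n) := rowsub f 1%:M.
have subE X : mxsub f f X = P *m X *m P ^t*.
  rewrite mul_rowsub_mx mul1mx; apply/matrixP=> i j; rewrite !mxE.
  rewrite (bigD1 (f j)) //= big1 ?addr0 => [|k kj]; rewrite !mxE.
    by rewrite eqxx conjC1 mulr1.
  by rewrite eq_sym (negPf kj) conjC0 mulr0.
rewrite !subE; apply: absmx_conj_isometry; apply/matrixP=> i j.
have [g fK gK] := bijf.
(* Column [i] of [P] has its only nonzero entry in row [g i]. *)
rewrite !mxE (bigD1 (g i)) //= big1 ?addr0 => [|k ki]; rewrite !mxE.
  by rewrite gK eqxx conjC1 mul1r.
suff /negPf-> : f k != i by rewrite conjC0 mul0r.
by apply: contra ki => /eqP <-; rewrite fK.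
Qed.

(** The trace is the sum of the nonnegative square roots of the eigenvalues of [M *m M ^t*]. If it
    vanishes, so does [M *m M ^t*], whose diagonal entries are the squared norms of the rows of
    [M]. *)
Lemma mxtrace_absmx_eq0 n (M : 'M[C]_n) : (\tr (absmx M) == 0) = (M == 0).
Proof.
have [_ d_ge0] := psd_spectral (psd_mulmx_trC M).
apply/eqP/eqP => [tr0|->]; last first.
  rewrite (_ : absmx 0 = 0) ?linear0 //; apply: sqrtmx_unique; rewrite ?mul0mx //.
  by have := psd_mulmx_trC (0 : 'M[C]_n); rewrite mul0mx.
have abs0 : absmx M = 0.
  move: tr0; rewrite /absmx /sqrtmx mxtrace_mulC mulmxA mulmxV ?spectral_unit //.
  rewrite mul1mx mxtrace_diag => /eqP; rewrite psumr_eq0 => [/allP d0|i _]; last first.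
    by rewrite mxE sqrtC_ge0.
  have -> : map_mx sqrtC (spectral_diag (M *m M ^t*)) = 0.
    by apply/rowP=> i; rewrite [RHS]mxE; apply/eqP/d0; rewrite mem_index_enum.
  by rewrite linear0 mulmx0 mul0mx.
have MM0 : M *m M ^t* = 0 by rewrite -sqr_absmx abs0 mul0mx.
apply/matrixP=> i j; move/matrixP/(_ i i): MM0; rewrite !mxE => /eqP.
rewrite psumr_eq0 => [/allP/(_ j)|k _]; last by rewrite !mxE mul_conjC_ge0.
by rewrite mem_index_enum !mxE mul_conjC_eq0 => /(_ isT) /eqP.
Qed.

(** Row [i] of [absmx M] and row [i] of [M] have the same norm: both squares are the [i]-th diagonal
    entry of [M *m M ^t*]. *)
Lemma absmx_row0 n (M : 'M[C]_n) i : row i M = 0 -> row i (absmx M) = 0.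
Proof.
move=> Mi0; have [herm _] := psd_absmx M.
have : (absmx M *m (absmx M) ^t*) i i = 0.
  rewrite herm sqr_absmx mxE big1 // => k _.
  by move/rowP/(_ k): Mi0; rewrite !mxE => ->; rewrite mul0r.
rewrite mxE => /eqP; rewrite psumr_eq0 => [/allP d0|k _]; last first.
  by rewrite !mxE mul_conjC_ge0.
apply/rowP=> j; have := d0 j; rewrite mem_index_enum !mxE mul_conjC_eq0.
by move=> /(_ isT) /eqP.
Qed.

End AbsoluteValue.

Section GraphEnergy.
Variable C : numClosedFieldType.

Lemma vertex_energy_iso m n (H : sgraph m) (G : sgraph n) (f : 'I_m -> 'I_n) :
    bijective f -> (forall x y, adj H x y = adj G (f x) (f y)) ->
  forall x, vertex_energy C H x = vertex_energy C G (f x).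
Proof.
move=> bijf adjf x; rewrite /vertex_energy.
have -> : adjmx C H = mxsub f f (adjmx C G).
  by apply/matrixP=> a b; rewrite !mxE adjf.
by rewrite absmx_reindex // mxE.
Qed.

Lemma energy_iso m n (H : sgraph m) (G : sgraph n) (f : 'I_m -> 'I_n) :
    bijective f -> (forall x y, adj H x y = adj G (f x) (f y)) ->
  energy C H = energy C G.
Proof.
move=> bijf adjf; rewrite /energy /mxtrace [RHS](reindex f) /=; last exact: onW_bij.
by apply: eq_bigr => x _; apply: vertex_energy_iso.
Qed.

Lemma energy_eq0 n (G : sgraph n) :
  (energy C G == 0) = [forall x, forall y, ~~ adj G x y].
Proof.
rewrite /energy mxtrace_absmx_eq0; apply/eqP/forallP => [A0 x|noedge].
  apply/forallP=> y; move/matrixP/(_ x y)/eqP: A0.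
  by rewrite !mxE pnatr_eq0 eqb0.
apply/matrixP=> x y; rewrite !mxE.
by have /forallP/(_ y)/negPf -> := noedge x.
Qed.

Lemma energy_game_eq0P n (G : sgraph n) (S : {set 'I_n}) :
  reflect {in S &, forall x y, ~~ adj G x y} (energy_game C G S == 0).
Proof.
rewrite /energy_game energy_eq0; apply: (iffP forallP) => [noedge x y xS yS|noedge a].
  have /forallP/(_ (enum_rank_in xS y)) := noedge (enum_rank_in xS x).
  by rewrite /= !enum_rankK_in.
by apply/forallP=> b; apply: noedge; apply: enum_valP.
Qed.

(** The case [x = y] is included: a single vertex carries no edge. *)
Lemma energy_game_pair_eq0 n (G : sgraph n) (x y : 'I_n) :
  (energy_game C G [set x; y] == 0) = ~~ adj G x y.
Proof.
apply/energy_game_eq0P/idP => [|nxy a b]; first by apply; rewrite !inE eqxx ?orbT.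
rewrite !inE => /orP[]/eqP-> /orP[]/eqP->; rewrite ?adj_irrefl //.
by rewrite adj_sym.
Qed.

(** Adding [i] to [[set j]] leaves the worth at that of a single vertex, which is zero. *)
Lemma null_player_isolated n (G : sgraph n) i :
  null_player (energy_game C G) i -> forall j, ~~ adj G i j.
Proof.
move=> null j; rewrite adj_sym -energy_game_pair_eq0.
move/eqP: (null [set j]); rewrite subr_eq0 => /eqP ->.
by apply/energy_game_eq0P=> a b /set1P-> /set1P->; rewrite adj_irrefl.
Qed.

Lemma symmetric_players_adj n (G : sgraph n) i j :
    symmetric_players (energy_game C G) i j ->
  forall k, k != i -> k != j -> adj G i k = adj G j k.
Proof.
move=> sym k ki kj; rewrite ![adj G _ k]adj_sym; apply: negb_inj.
rewrite -!energy_game_pair_eq0 sym // sub1set !inE.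
by rewrite (negPf ki) (negPf kj).
Qed.

(** The hypothesis matters only when exactly one of [x], [y] lies in [{i, j}]; if both do, symmetry
    and irreflexivity of [adj] suffice. *)
Lemma adj_tperm n (G : sgraph n) i j :
    (forall k, k != i -> k != j -> adj G i k = adj G j k) ->
  forall x y, adj G x y = adj G (tperm i j x) (tperm i j y).
Proof.
move=> twin x y.
case: tpermP => [->|->|/eqP xi /eqP xj]; case: tpermP => [->|->|/eqP yi /eqP yj] //;
  rewrite ?adj_irrefl //; first [exact: adj_sym | exact: twin | exact/esym/twin | idtac].
  by rewrite ![adj G x _]adj_sym; apply: twin.
by rewrite ![adj G x _]adj_sym; apply/esym/twin.
Qed.

End GraphEnergy.

Theorem theorem3p8 (C : numClosedFieldType) (n : nat) (G : sgraph n) :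
  [/\ \sum_(i < n) vertex_energy C G i = energy_game C G [set: 'I_n],
      forall i j : 'I_n, symmetric_players (energy_game C G) i j ->
        vertex_energy C G i = vertex_energy C G j
    & forall i : 'I_n, null_player (energy_game C G) i ->
        vertex_energy C G i = 0].
Proof.
split=> [|i j sym|i null].
(* The subgraph induced by all vertices is a renumbered copy of [G], with [enum_val] as the
   isomorphism. *)
- apply/esym/(@energy_iso C _ _ _ G enum_val) => //.
  apply: inj_card_bij; first exact: enum_val_inj.
  by rewrite !card_ord cardsT card_ord.
- have twin := adj_tperm (symmetric_players_adj sym).
  rewrite (vertex_energy_iso C _ twin) ?tpermL //.
  by apply: injF_bij; apply: perm_inj.
- have row0 : row i (adjmx C G) = 0.
    by apply/rowP=> j; rewrite !mxE (negPf (null_player_isolated null j)).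
  by move/rowP/(_ i): (absmx_row0 row0); rewrite [LHS]mxE [RHS]mxE.
Qed.
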